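(* Let $\mathbf S=(S_{t,k})_{t,k=1}^n$, $S_{t,k}\in\mathrm M_d(\mathbb C)$, be the post-selected block sub-matrix of the single-particle propagator determined by a collision-free record. Fix fusion outcomes $\boldsymbol\beta=(\beta_1,\dots,\beta_n)\in(\mathbb Z_d^2)^n$ and define the dressed blocks $\widetilde S_{t,k}:=S_{t,k}^{\top}\hat D_{\beta_t}$ in the fixed contraction order $t=1,\dots,n$. Then the branch operator $\mathcal T_{\boldsymbol\beta}(\mathbf S)\in\mathrm M_d(\mathbb C)$ is an ordered non-commutative trace polynomial in the dressed blocks, with scalar trace factors generated by closed wiring loops. Formally, $\mathcal T_{\boldsymbol\beta}(\mathbf S)$ is the matrix evaluation of an element of the free trace-polynomial algebra $\mathbb C\langle\widetilde S\rangle_{\operatorname{Tr}}$.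
   Context: Post-selected sub-matrix: $d\ge2$; $\mathbf V=(V_{j,k})_{j,k=1}^m\in\mathrm U(dm)$, with blocks $V_{j,k}\in\mathrm M_d(\mathbb C)$, is the single-particle propagator of a number-conserving free-fermion (fermionic linear optics) circuit on $m$ spatial blocks of $d$ modes each, with $n$ input fermions, one in each of the blocks $m-n+1,\dots,m$. A collision-free record selects $n$ singly occupied output blocks $\ell_1<\dots<\ell_n$, and $S_{t,k}:=V_{\ell_t,\,m-n+k}$ for $1\le t,k\le n$. Weyl operators: with $\zeta=e^{2\pi i/d}$, $X|k\rangle=|k+1\bmod d\rangle$, $Z|k\rangle=\zeta^k|k\rangle$, and $\hat D_{(a,b)}=X^aZ^b$ for $(a,b)\in\mathbb Z_d^2$. Let $|\Phi_d^+\rangle=d^{-1/2}\sum_{k=0}^{d-1}|k,k\rangle$. Kernel: $\det_\otimes(\mathbf S)=\sum_{\sigma\in\mathfrak S_n}\operatorname{sgn}(\sigma)\bigl(\bigotimes_{t=1}^nS_{t,\sigma(t)}\bigr)\mathcal P_{\sigma^{-1}}$ on $(\mathbb C^d)^{\otimes n}$, where $\mathcal P_\sigma(v_1\otimes\cdots\otimes v_n)=v_{\sigma^{-1}(1)}\otimes\cdots\otimes v_{\sigma^{-1}(n)}$. Branch operator: take $d$-level systems $A_0,\dots,A_n$ and $Q_1,\dots,Q_n$. For an operator $K$ on $Q_1\cdots Q_n$, let $\mathcal C_{\boldsymbol\beta}(K)\in\mathrm M_d(\mathbb C)$ be the operator from $A_0$ to $A_n$ given by $$\mathcal C_{\boldsymbol\beta}(K)|\psi\rangle=\Bigl(\bigotimes_{t=1}^n\langle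 B_{\beta_t}|_{A_{t-1},Q_t}\Bigr)K_{Q_1\cdots Q_n}\Bigl(|\psi\rangle_{A_0}\otimes\bigotimes_{k=1}^n|\Phi_d^+\rangle_{Q_k,A_k}\Bigr),$$ where $\langle B_\beta|_{1,2}=\langle\Phi_d^+|_{1,2}(\hat D_\beta\otimes\mathbb 1)$ is the Bell projection with outcome labelled so that its byproduct is $\hat D_\beta$, i.e. $\langle B_\beta|_{1,2}\bigl(|\psi\rangle_1\otimes(\xi\otimes\mathbb 1)|\Phi_d^+\rangle_{2,3}\bigr)=d^{-1}\xi^\top\hat D_\beta|\psi\rangle_3$. (Up to a unit-modulus phase this is the Bell basis $|\Phi_\beta\rangle=(\mathbb 1\otimes\hat D_\beta^\dagger)|\Phi_d^+\rangle$ with outcome label $(a,b)$ replaced by $(-a,b)$.) The branch operator is $\mathcal T_{\boldsymbol\beta}(\mathbf S):=\mathcal C_{\boldsymbol\beta}(\det_\otimes(\mathbf S))$. Wiring loops: for $\sigma\in\mathfrak S_n$, the wiring graph of the $\sigma$-term is the directed graph on $\{A_0,\dots,A_n\}$ with edges $A_{t-1}\to A_{\sigma(t)}$ labelled $\widetilde S_{t,\sigma(t)}$, $t=1,\dots,n$; its closed wiring loops are its directed cycles. Products of dressed blocks are ordered by map composition, with later maps on the left. Free trace-polynomial algebra: $\mathbb C\langle\widetilde S\rangle_{\operatorname{Tr}}=\mathbb C\langle\widetilde S_{t,k}:1\le t,k\le n\rangle\otimes\mathbb C[\tau_\gamma]$, where the $\widetilde S_{t,k}$ are regarded as free non-commuting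 generators and there is one central commuting indeterminate $\tau_\gamma$ for each cyclic equivalence class $\gamma$ of non-empty words in the generators. Matrix evaluation sends each generator to the corresponding dressed block and $\tau_\gamma$ to the unnormalized trace of the matrix word representing $\gamma$. *)

(* Defs.v *)
From HB Require Import structures.
From mathcomp Require Import all_boot all_order all_algebra all_fingroup.
From mathcomp Require Import spectral generic_quotient finmap complex monalg.
From mathcomp Require Import boolp reals trigo.

Set Implicit Arguments.
Unset Strict Implicit.
Unset Printing Implicit Defensive.

Import Order.TTheory GRing.Theory Num.Theory.
Local Open Scope ring_scope.
Local Open Scope quotient_scope.

(* All indices are 0-based: t, k < n, modes in 'I_d, blocks in 'I_m, and the
   systems A_0, ..., A_n are indexed by 'I_n.+1. *)

Lemma input_block_subproof (n m : nat) (le_nm : (n <= m)%N) (k : 'I_n) :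
  (m - n + k < m)%N.
Proof. by rewrite -ltn_subRL subKn. Qed.

Definition input_block (n m : nat) (le_nm : (n <= m)%N) (k : 'I_n) : 'I_m :=
  Ordinal (input_block_subproof le_nm k).

Definition post_selected (C : Type) (d n m : nat) (le_nm : (n <= m)%N)
    (V : 'I_m -> 'I_m -> 'M[C]_d) (l : 'I_n -> 'I_m) : 'I_n -> 'I_n -> 'M[C]_d :=
  fun t k => V (l t) (input_block le_nm k).

Section Weyl.
Variables (R : realType) (d : nat).
Local Notation C := R[i].

Definition zeta : C := (cos (2 * pi / d%:R) +i* sin (2 * pi / d%:R))%C.

Definition shift_mx : 'M[C]_d := \matrix_(i, j) (i == ordS j)%:R.

Definition clock_mx : 'M[C]_d := \matrix_(i, j) (zeta ^+ j *+ (i == j)).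

(* Elements of Z_d^2 are given by their representatives in {0, .., d-1}^2. *)
Definition weyl (b : 'I_d * 'I_d) : 'M[C]_d :=
  shift_mx ^+ b.1 * clock_mx ^+ b.2.

Definition max_ent (x y : 'I_d) : C := (sqrtC d%:R)^-1 * (x == y)%:R.

(* <Phi|_{1,2} (D_b (x) 1) |x, y> *)
Definition bell_bra (b : 'I_d * 'I_d) (x y : 'I_d) : C :=
  \sum_(u < d) \sum_(v < d)
    (max_ent u v)^* * (weyl b u x * (1%:M : 'M[C]_d) v y).

End Weyl.

Section Kernel.
Variables (C : numClosedFieldType) (d n : nat).

Definition multi_index := {ffun 'I_n -> 'I_d}.
Definition tensor_op := multi_index -> multi_index -> C.

Definition op_mul (A B : tensor_op) : tensor_op :=
  fun x z => \sum_(y : multi_index) A x y * B y z.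

Definition op_tensor (A : 'I_n -> 'M[C]_d) : tensor_op :=
  fun x y => \prod_(t < n) A t (x t) (y t).

(* The basis vector |y> is sent to |y o s^-1>. *)
Definition op_perm (s : 'S_n) : tensor_op :=
  fun x y => (x == [ffun t => y ((s^-1)%g t)])%:R.

Definition det_tensor (S : 'I_n -> 'I_n -> 'M[C]_d) : tensor_op :=
  fun x y => \sum_(s : 'S_n)
    (-1) ^+ s * op_mul (op_tensor (fun t => S t (s t))) (op_perm (s^-1)%g) x y.

End Kernel.

Section Branch.
Variables (R : realType) (d n : nat).
Local Notation C := R[i].

(* [a] ranges over the basis states of A_0 ... A_n, and [q], [q'] over those of
   Q_1 ... Q_n after, resp. before, the application of [K]. *)
Definition branch_act (b : 'I_n -> 'I_d * 'I_d) (K : tensor_op C d n)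
    (psi : 'cV[C]_d) : 'cV[C]_d :=
  \col_(o < d)
    \sum_(a : {ffun 'I_n.+1 -> 'I_d} | a ord_max == o)
    \sum_(q : multi_index d n)
      (\prod_(t < n) bell_bra R (b t) (a (widen_ord (leqnSn n) t)) (q t)) *
      \sum_(q' : multi_index d n)
        K q q' *
        (psi (a ord0) 0 * \prod_(k < n) max_ent R (q' k) (a (lift ord0 k))).

Definition branch_contraction (b : 'I_n -> 'I_d * 'I_d) (K : tensor_op C d n) :
    'M[C]_d :=
  \matrix_(i, j) branch_act b K (delta_mx j 0) i 0.

Definition branch_op (b : 'I_n -> 'I_d * 'I_d) (S : 'I_n -> 'I_n -> 'M[C]_d) :
    'M[C]_d :=
  branch_contraction b (det_tensor S).

Definition dressed (b : 'I_n -> 'I_d * 'I_d) (S : 'I_n -> 'I_n -> 'M[C]_d)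
    (g : 'I_n * 'I_n) : 'M[C]_d :=
  (S g.1 g.2)^T * weyl R (b g.1).

End Branch.

Section CyclicWords.
Variable I : choiceType.

Definition nonempty_word := {w : seq I | w != [::]}.

Definition rotation (u v : nonempty_word) : bool :=
  val v \in [seq rot i (val u) | i <- iota 0 (size (val u))].

Lemma rotationP (u v : nonempty_word) :
  reflect (exists i, val v = rot i (val u)) (rotation u v).
Proof.
apply: (iffP mapP) => [[i _ ->]|[i Ei]]; first by exists i.
have u_gt0 : (0 < size (val u))%N by rewrite lt0n size_eq0 (valP u).
have [lt_iu|le_ui] := ltnP i (size (val u)).
  by exists i; rewrite // mem_iota.
by exists 0%N; rewrite ?mem_iota // Ei rot_oversize // rot0.
Qed.

Lemma rotation_equiv : equiv_class_of rotation.
Proof.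
split=> [u|u v|v u w].
- by apply/rotationP; exists 0%N; rewrite rot0.
- have sym x y : rotation x y -> rotation y x.
    move=> /rotationP[i Ei]; apply/rotationP; exists (size (val y) - i)%N.
    by rewrite -/(rotr i _) Ei rotK.
  by apply/idP/idP; apply: sym.
- move=> /rotationP[i Ei] /rotationP[j Ej]; apply/rotationP.
  have [ui|ui] := leqP i (size (val u)); last first.
    by exists j; rewrite Ej Ei (rot_oversize (ltnW ui)).
  have [uj|uj] := leqP j (size (val u)); last first.
    by exists i; rewrite Ej rot_oversize Ei // size_rot ltnW.
  by rewrite Ej Ei rot_add_mod //; eexists.
Qed.

Canonical rotation_equiv_rel := EquivRelPack rotation_equiv.

Definition cyclic_word := {eq_quot rotation_equiv_rel}.
HB.instance Definition _ := Choice.on cyclic_word.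
HB.instance Definition _ := EqQuotient.on cyclic_word.

End CyclicWords.

Section MonomialProduct.
Variables M N : monomType.
Implicit Types x y : M * N.

Definition prod_mone : M * N := (mone, mone).
Definition prod_mmul x y : M * N := (mmul x.1 y.1, mmul x.2 y.2).

Lemma prod_mmulA : associative prod_mmul.
Proof. by move=> x y z; rewrite /prod_mmul !mulmA. Qed.

Lemma prod_mul1m : left_id prod_mone prod_mmul.
Proof. by case=> x y; rewrite /prod_mmul !mul1m. Qed.

Lemma prod_mulm1 : right_id prod_mone prod_mmul.
Proof. by case=> x y; rewrite /prod_mmul !mulm1. Qed.

Lemma prod_unitm x y : prod_mmul x y = prod_mone -> x = prod_mone /\ y = prod_mone.
Proof.
by case: x y => [x1 x2] [y1 y2] [] /unitm[-> ->] /unitm[-> ->].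
Qed.

HB.instance Definition _ := Choice_isMonomialDef.Build (M * N)%type
  prod_mmulA prod_mul1m prod_mulm1 prod_unitm.

End MonomialProduct.

Section TracePolynomials.
Variables (C : numClosedFieldType) (n : nat).

Definition gen := ('I_n * 'I_n)%type.

(* Monomials are pairs of a word in the generators and a commutative monomial
   in the tau_gamma, so that the monoid algebra below is
   C<S~_{t,k}> (x) C[tau_gamma]. *)
Definition trace_monomial := ({fmonom gen} * {cmonom (cyclic_word gen)})%type.

Definition trace_poly := {malg C[trace_monomial]}.

Variables (d : nat) (A : gen -> 'M[C]_d).

Definition word_eval (w : seq gen) : 'M[C]_d := \prod_(g <- w) A g.

Definition trace_eval (c : cyclic_word gen) : C := \tr (word_eval (val (repr c))).

Lemma trace_eval_pi (w : nonempty_word gen) :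
  trace_eval (\pi_(cyclic_word gen) w) = \tr (word_eval (val w)).
Proof.
have /eqmodP/rotationP[i Ei] := reprK (\pi_(cyclic_word gen) w).
rewrite /trace_eval Ei /word_eval.
rewrite /rot big_cat /= -[in LHS](cat_take_drop i (val (repr _))) big_cat /=.
exact: mxtrace_mulC.
Qed.

Definition trace_monomial_eval (mu : trace_monomial) : 'M[C]_d :=
  (\prod_(c <- finsupp (cmonom_val mu.2)) trace_eval c ^+ mu.2 c)
    *: word_eval mu.1.

Definition trace_poly_eval (p : trace_poly) : 'M[C]_d :=
  \sum_(mu <- msupp p) p@_mu *: trace_monomial_eval mu.

End TracePolynomials.

Section Wiring.
Variables (n : nat) (s : 'S_n).

(* The edges of the wiring graph are indexed by t : 'I_n. *)
Definition edge_src (t : 'I_n) : 'I_n.+1 := widen_ord (leqnSn n) t.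
Definition edge_tgt (t : 'I_n) : 'I_n.+1 := lift ord0 (s t).
Definition edge_label (t : 'I_n) : gen n := (t, s t).

Fixpoint walk (x : 'I_n.+1) (e : seq 'I_n) (y : 'I_n.+1) : bool :=
  if e is t :: e' then (edge_src t == x) && walk (edge_tgt t) e' y else x == y.

Definition directed_cycle (e : seq 'I_n) : Prop :=
  [/\ e != [::], uniq (map edge_src e) & exists x, walk x e x].

(* Composition order: the label of the last edge is the leftmost letter. *)
Definition walk_word (e : seq 'I_n) : seq (gen n) := rev (map edge_label e).

Definition closed_loop (c : cyclic_word (gen n)) : Prop :=
  exists (e : seq 'I_n) (w : nonempty_word (gen n)),
    [/\ directed_cycle e, val w = walk_word e & c = \pi w].

(* The word is the product along a directed walk from A_0 to A_n, and the
   scalar factor is the product of the tau_c over the closed loops c; distinct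
   directed cycles are vertex-disjoint, hence every exponent is 0 or 1. *)
Definition wiring_monomial (mu : trace_monomial n) : Prop :=
  (exists e, walk ord0 e ord_max /\ mu.1 = walk_word e :> seq (gen n)) /\
  (forall c, mu.2 c = `[< closed_loop c >] :> nat).

End Wiring.

Definition ordered_wiring_poly (C : numClosedFieldType) (n : nat)
    (p : trace_poly C n) : Prop :=
  forall mu, mu \in msupp p -> exists s : 'S_n, wiring_monomial s mu.

(* Main.v *)
Require Import Defs.
From mathcomp Require Import all_boot all_order all_algebra all_fingroup.
From mathcomp Require Import generic_quotient finmap monalg boolp ring.
From mathcomp Require Import spectral complex reals.

Set Implicit Arguments.
Unset Strict Implicit.
Unset Printing Implicit Defensive.

Import Order.TTheory GRing.Theory Num.Theory.
Local Open Scope ring_scope.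

(* Expanding the branch operator in the computational basis, its (i, j) entry
   is d^-n times the signed sum over s in S_n of the sums, over all labellings
   a of A_0, ..., A_n by basis states with a_0 = j and a_n = i, of the products
   of the entries (a_(s t), a_(t-1)) of the dressed blocks S~_(t, s t).  An
   additional edge from A_n to A_0 carrying the elementary matrix E_(j,i)
   replaces the boundary conditions and makes the wiring graph a permutation,
   so that the sum over labellings is the product over the cycles of the traces
   of the ordered products of the blocks.  The cycle through A_n contributes
   tr (E_(j,i) W) = W_(i,j), where W is the word of the path from A_0 to A_n;
   the other cycles are the closed wiring loops. *)


(** * Summation over labellings, one coordinate at a time *)

Section IteratedSum.
Variables (C : comNzRingType) (T I : finType).
Implicit Types (a b : {ffun T -> I}) (F G : {ffun T -> I} -> C).

Definition update a x v : {ffun T -> I} :=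
  [ffun y => if y == x then v else a y].

(** A sum over all labellings is written as nested sums along a list of coordinates, so that cutting
    the list into cycles factors the sum. Coordinates outside [xs] keep their value in [a]. *)
Fixpoint iter_sum (xs : seq T) F a : C :=
  if xs is x :: xs' then \sum_v iter_sum xs' F (update a x v) else F a.

Definition indep (xs : seq T) F :=
  forall a x v, x \in xs -> F (update a x v) = F a.

Lemma eq_iter_sum xs F G : F =1 G -> iter_sum xs F =1 iter_sum xs G.
Proof. by move=> FG; elim: xs => //= x xs IH a; apply: eq_bigr => v _. Qed.

Lemma iter_sum_cat xs ys F a :
  iter_sum (xs ++ ys) F a = iter_sum xs (iter_sum ys F) a.
Proof. by elim: xs a => //= x xs IH a; apply: eq_bigr. Qed.

Lemma iter_sumZ xs F G a : indep xs F ->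
  iter_sum xs (fun b => F b * G b) a = F a * iter_sum xs G a.
Proof.
elim: xs a => //= x xs IH a indF; rewrite big_distrr; apply: eq_bigr => v _.
rewrite IH => [|b y w y_xs]; first by rewrite indF ?mem_head.
by rewrite indF // inE y_xs orbT.
Qed.

Lemma indep_iter_sum xs ys F : indep xs F -> {in xs, forall x, x \notin ys} ->
  indep xs (iter_sum ys F).
Proof.
move=> indF; elim: ys => [_|y ys IH dis] a x v x_xs /=; first exact: indF.
apply: eq_bigr => w _; have := dis x x_xs; rewrite inE => /norP[xy _].
rewrite -(IH _ (update a y w) x v) //; last first.
  by move=> z /dis; rewrite inE => /norP[].
congr iter_sum; apply/ffunP=> z; rewrite !ffunE.
by case: eqVneq => // ->; rewrite eq_sym (negPf xy).
Qed.

(** As [xs] has no repetition, each coordinate is overwritten once, and every labelling agreeing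
    with [a] off [xs] is reached exactly once. *)
Lemma iter_sumE xs F a : uniq xs ->
  iter_sum xs F a =
  \sum_(b : {ffun T -> I} | [forall x, (x \notin xs) ==> (b x == a x)]) F b.
Proof.
elim: xs a => [|x xs IH] a /=.
  move=> _; rewrite (big_pred1 a) // => b; apply/forallP/eqP => [ba|-> x] /=.
    by apply/ffunP=> x; apply/eqP; have := ba x.
  by rewrite eqxx.
case/andP=> x_xs uniq_xs.
rewrite [RHS](partition_big (fun b : {ffun T -> I} => b x) predT) //=.
apply: eq_bigr => v _; rewrite IH //; apply: eq_bigl => b.
apply/forallP/andP => [bP|[/forallP bP /eqP bx] y].
  split; last by have := bP x; rewrite x_xs ffunE eqxx.
  apply/forallP=> y; have := bP y; rewrite inE ffunE.
  by case: (y == x).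
have := bP y; rewrite inE ffunE; case: eqVneq => [->|//] _.
by rewrite bx eqxx implybT.
Qed.

Lemma iter_sum_all xs F a : uniq xs -> (forall x, x \in xs) ->
  iter_sum xs F a = \sum_b F b.
Proof.
move=> uniq_xs xsT; rewrite iter_sumE //; apply: eq_bigl => b.
by apply/forallP=> x; rewrite xsT.
Qed.

End IteratedSum.

(** * Sums over labellings of a permutation as products of traces *)

Section TraceOfCycles.
Variables (C : comNzRingType) (T : finType) (d : nat).
Variables (f : T -> T) (B : T -> 'M[C]_d).
Implicit Types (a : {ffun T -> 'I_d}) (p c : seq T).

Definition cycle_weight p a : C := \prod_(x <- p) B x (a (f x)) (a x).

(** Summing over the label of an intermediate vertex is a matrix multiplication. The row index of
    [B x] is the label of [f x], so later vertices stand on the left, whence [rev]. The end [y] may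
    equal [x], which is the case of a cycle. *)
Lemma iter_sum_path x p y a :
    path (frel f) x p -> f (last x p) = y -> uniq (x :: p) -> y \notin p ->
  iter_sum p (cycle_weight (x :: p)) a
    = (\prod_(z <- rev (x :: p)) B z) (a y) (a x).
Proof.
elim: p x a => [|z p IH] x a /=.
  by move=> _ <- _ _; rewrite /cycle_weight !big_seq1.
case/andP=> /eqP fx zp last_y /andP[xzp uniq_zp] y_zp.
rewrite rev_cons -cats1 big_cat big_seq1 [RHS]mxE.
have [yz yp] : y != z /\ y \notin p by apply/norP; rewrite -in_cons.
have [xz xp] : x != z /\ x \notin p by apply/norP; rewrite -in_cons.
apply: eq_bigr => v _; under eq_iter_sum do rewrite /cycle_weight big_cons fx.
rewrite (iter_sumZ (F := fun b => B x (b z) (b x))); last first.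
  move=> b t w tp; rewrite !ffunE; case: eqVneq => [zt|_].
    by move: uniq_zp; rewrite /= zt tp.
  by case: eqVneq => // xt; rewrite xt tp in xp.
by rewrite mulrC (IH z) // !ffunE eqxx (negPf yz) (negPf xz).
Qed.

(** A cycle is a path with [y = x]; the remaining sum over the label of [x] is the trace. *)
Lemma iter_sum_cycle c a : c != [::] -> fcycle f c -> uniq c ->
  iter_sum c (cycle_weight c) a = \tr (\prod_(z <- rev c) B z).
Proof.
case: c => // x p _; rewrite (cycle_path x) /= => /andP[/eqP fl xp] uniq_xp.
apply: eq_bigr => v _; rewrite (@iter_sum_path x p x) ?ffunE ?eqxx //.
by case/andP: uniq_xp.
Qed.

Lemma indep_cycle_weight c p : {in p, forall x, x \notin c /\ f x \notin c} ->
  indep c (cycle_weight p).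
Proof.
move=> dis a x v xc; rewrite /cycle_weight big_seq [RHS]big_seq.
apply: eq_bigr => y /dis[yc fyc]; rewrite !ffunE.
case: eqVneq fyc => [->|_ _]; first by rewrite xc.
by case: eqVneq yc => // ->; rewrite xc.
Qed.

(** Each weight reads labels only at vertices [x] and [f x] of its own cycle. Cycles are stable
    under [f] and disjoint, so each weight is constant for the sums over the other cycles and can be
    pulled out of them. *)
Lemma iter_sum_flatten (cs : seq (seq T)) a :
    [::] \notin cs -> all (fcycle f) cs -> uniq (flatten cs) ->
  iter_sum (flatten cs) (cycle_weight (flatten cs)) a
    = \prod_(c <- cs) \tr (\prod_(z <- rev c) B z).
Proof.
elim: cs a => [|c cs IH] a /=; first by rewrite /cycle_weight !big_nil.
rewrite inE eq_sym => /norP[c0 cs0] /andP[fc fcs]; rewrite cat_uniq big_cons.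
case/and3P=> uniq_c /hasPn dis uniq_cs; rewrite iter_sum_cat.
have f_cs x : x \in flatten cs -> f x \in flatten cs.
  case/flattenP=> c' c'cs xc'; apply/flattenP; exists c' => //.
  have /allP/(_ _ c'cs) fc' := fcs.
  by rewrite (eqP (next_cycle fc' xc')) mem_next.
have ind_cs : indep c (cycle_weight (flatten cs)).
  by apply: indep_cycle_weight => x x_cs; split; apply: dis; rewrite ?f_cs.
have ind_c : indep (flatten cs) (cycle_weight c).
  apply: indep_cycle_weight => x xc; split; apply/negP=> /dis.
    by rewrite xc.
  by rewrite (eqP (next_cycle fc xc)) /= mem_next xc.
have ind_sum : indep c (iter_sum (flatten cs) (cycle_weight (flatten cs))).
  by apply: indep_iter_sum => // x xc; apply/negP=> /dis; rewrite xc.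
rewrite -(IH a) // -(iter_sum_cycle a) // [RHS]mulrC -iter_sumZ //.
apply: eq_iter_sum => b; rewrite mulrC -iter_sumZ //; apply: eq_iter_sum => {}b.
by rewrite /cycle_weight big_cat.
Qed.

(** The index [i0] supplies a starting labelling; all its values are overwritten, because the cycles
    cover [T]. *)
Lemma sum_cycle_weight (i0 : 'I_d) (cs : seq (seq T)) :
    [::] \notin cs -> all (fcycle f) cs -> uniq (flatten cs) ->
    (forall x, x \in flatten cs) ->
  \sum_(a : {ffun T -> 'I_d}) \prod_x B x (a (f x)) (a x)
    = \prod_(c <- cs) \tr (\prod_(z <- rev c) B z).
Proof.
move=> cs0 fcs uniq_cs csT.
rewrite -(iter_sum_flatten [ffun=> i0]) //; rewrite iter_sum_all //.
apply: eq_bigr => a _; rewrite /cycle_weight [RHS]big_uniq //.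
by apply: eq_bigl => x; rewrite csT.
Qed.

End TraceOfCycles.


(** * The spine and the closed loops of the wiring graph *)

Section WiringLoops.
Variables (n : nat) (s : 'S_n).
Local Open Scope nat_scope.

(** The edge leaving a vertex; it is [None] exactly at A_n. *)
Definition edge_of (x : 'I_n.+1) : option 'I_n := insub (val x).

Lemma edge_srcK : pcancel (@edge_src n) edge_of.
Proof. by move=> t; rewrite /edge_of /= valK. Qed.

Lemma edge_src_inj : injective (@edge_src n).
Proof. exact: pcan_inj edge_srcK. Qed.

Lemma edge_ofK : ocancel edge_of (@edge_src n).
Proof.
by move=> x; rewrite /edge_of; case: insubP => //= t _ tx; apply: val_inj.
Qed.

Lemma edge_of_max : edge_of (@ord_max n) = None.
Proof. by rewrite /edge_of insubF //= ltnn. Qed.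

Lemma edge_of_eqP x : x != @ord_max n -> {t | x = edge_src t}.
Proof.
move=> x_max; have lt_xn : x < n.
  by rewrite ltn_neqAle -ltnS ltn_ord andbT -val_eqE in x_max *.
by exists (Ordinal lt_xn); apply: val_inj.
Qed.

Lemma edge_src_neq_max t : edge_src t != @ord_max n.
Proof. by rewrite -val_eqE /= neq_ltn ltn_ord. Qed.

(* The wiring graph is made a permutation by joining A_n to A_0. *)
Definition wire x : 'I_n.+1 :=
  if edge_of x is Some t then edge_tgt s t else ord0.

Lemma wire_src t : wire (edge_src t) = edge_tgt s t.
Proof. by rewrite /wire edge_srcK. Qed.

Lemma wire_max : wire ord_max = ord0.
Proof. by rewrite /wire edge_of_max. Qed.

(** Edges have distinct targets because [s] is injective, and no edge enters A_0, which is reached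
    only from A_n. *)
Lemma wire_inj : injective wire.
Proof.
move=> x y; have [->|/edge_of_eqP[t ->]] := eqVneq x ord_max;
  have [->|/edge_of_eqP[u ->]] := eqVneq y ord_max;
  rewrite ?wire_max ?wire_src //; try by move/(congr1 val).
by move/lift_inj/perm_inj->.
Qed.

Definition edges (p : seq 'I_n.+1) : seq 'I_n := pmap edge_of p.

Lemma map_edges p : @ord_max n \notin p -> map (@edge_src n) (edges p) = p.
Proof.
move=> p_max; rewrite (pmap_filter edge_ofK); apply/all_filterP/allP=> x xp.
have [x_max|/edge_of_eqP[t ->]] := eqVneq x ord_max; last by rewrite edge_srcK.
by rewrite -x_max xp in p_max.
Qed.

Lemma mem_edges t p : (t \in edges p) = (edge_src t \in p).
Proof.
rewrite mem_pmap; apply/mapP/idP => [[x xp tx]|tp].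
  by have := edge_ofK x; rewrite -tx /= => ->.
by exists (edge_src t); rewrite ?edge_srcK.
Qed.

Lemma edges_map e : edges (map (@edge_src n) e) = e.
Proof. exact: map_pK edge_srcK _. Qed.

Lemma walk_edges x p : fpath wire x p -> @ord_max n \notin belast x p ->
  walk s x (edges (belast x p)) (last x p).
Proof.
elim: p x => [|y p IH] x /=; first by rewrite eqxx.
case/andP=> /eqP fx yp; rewrite inE eq_sym => /norP[/edge_of_eqP[t xt] p_max].
by rewrite xt /= edge_srcK /= eqxx -wire_src -xt fx IH.
Qed.

Lemma fpath_walk t e y : walk s (edge_tgt s t) e y ->
  fpath wire (edge_src t) (rcons (map (@edge_src n) e) y).
Proof.
elim: e t => [|u e IH] t /=; first by rewrite wire_src andbT.
by case/andP=> /eqP tu /IH path_u; rewrite wire_src -tu eqxx.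
Qed.

Notation orb x := (fingraph.orbit wire x).

(** The orbit of A_0 closes up at the predecessor of A_0, which is A_n by injectivity. Cutting the
    added edge leaves a walk from A_0 to A_n. *)
Lemma orbit_spine : {q | [/\ orb ord0 = rcons q ord_max, @ord_max n \notin q &
  walk s ord0 (edges (orb ord0)) ord_max]}.
Proof.
have uniq_o := orbit_uniq wire ord0; have := cycle_orbit wire_inj ord0.
have [p orb_p] : {p | orb ord0 = ord0 :: p}.
  by rewrite /fingraph.orbit -orderSpred; eexists.
rewrite orb_p (cycle_path ord0) => /andP[/eqP wire_last path_p].
have last_p : last ord0 p = ord_max.
  by apply: wire_inj; rewrite wire_max -[RHS]wire_last.
have max_bel : @ord_max n \notin belast ord0 p.
  by have := uniq_o; rewrite orb_p lastI last_p rcons_uniq => /andP[].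
exists (belast ord0 p); rewrite lastI last_p; split=> //.
rewrite -cats1 /edges pmap_cat /= edge_of_max cats0 -[X in walk _ _ _ X]last_p.
exact: walk_edges.
Qed.

Definition spine_word := walk_word s (edges (orb ord0)).

Lemma edges_orbit_src t :
  edges (orb (edge_src t)) = t :: edges (behead (orb (edge_src t))).
Proof. by rewrite /fingraph.orbit -orderSpred /= edge_srcK. Qed.

Lemma loop_word_subproof t : walk_word s (edges (orb (edge_src t))) != [::].
Proof.
by rewrite edges_orbit_src /walk_word -size_eq0 size_rev size_map.
Qed.

Definition loop_word t : nonempty_word (gen n) :=
  exist (fun w => w != [::]) _ (loop_word_subproof t).

(** Selects one edge in each cycle avoiding A_0: the one whose source is the canonical
    representative of its orbit. *)
Definition is_loop_root t :=
  froots wire (edge_src t) && ~~ fconnect wire ord0 (edge_src t).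

Definition loop_roots := [seq t <- enum 'I_n | is_loop_root t].

Definition loop_words : seq (cyclic_word (gen n)) :=
  [seq (\pi_(cyclic_word (gen n)) (loop_word t))%qT | t <- loop_roots].

Let symf := fconnect_sym wire_inj.

Lemma fconnect_spine : fconnect wire ord0 ord_max.
Proof. by rewrite symf -[X in connect _ _ X]wire_max fconnect1. Qed.

Lemma orbit_max t : is_loop_root t -> @ord_max n \notin orb (edge_src t).
Proof.
case/andP=> _; apply: contraNN; rewrite -fconnect_orbit symf.
exact: connect_trans fconnect_spine.
Qed.

Lemma mem_walk_word t e : ((t, s t) \in walk_word s e) = (t \in e).
Proof.
by rewrite mem_rev; apply/mapP/idP => [[u ue [->]]|te] //; exists t.
Qed.

(** The letter [(t, s t)] survives rotation and determines [t]. Two roots with the same cyclic word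
    therefore lie in one orbit, and canonical representatives of one orbit coincide. *)
Lemma uniq_loop_words : uniq loop_words.
Proof.
rewrite map_inj_in_uniq; first exact/filter_uniq/enum_uniq.
move=> t u; rewrite !mem_filter => /andP[t_root _] /andP[u_root _].
case/eqmodP/rotationP=> i /= /(congr1 (fun w : seq _ => (t, s t) \in w)).
rewrite mem_rot !mem_walk_word (edges_orbit_src t) mem_head mem_edges.
rewrite -fconnect_orbit.
have /andP[/eqP rt _] := t_root; have /andP[/eqP ru _] := u_root.
by rewrite -root_connect // rt ru => /eqP/edge_src_inj.
Qed.

Lemma directed_cycle_loop t : is_loop_root t ->
  directed_cycle s (edges (orb (edge_src t))).
Proof.
move=> t_root; split; first by rewrite edges_orbit_src.
  by rewrite map_edges ?orbit_uniq ?orbit_max.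
exists (edge_src t); have := orbit_max t_root.
have := cycle_orbit wire_inj (edge_src t).
rewrite /fingraph.orbit -orderSpred /=; set p := traject _ _ _ => path_p max_p.
have := walk_edges path_p; rewrite last_rcons belast_rcons; exact.
Qed.

Lemma walk_word_rot i e :
  exists j, walk_word s (rot i e) = rot j (walk_word s e).
Proof.
exists (size e - i); rewrite /walk_word map_rot rev_rot /rotr.
by rewrite size_rev size_map.
Qed.

(** A directed cycle, read through its sources, is a cycle of [wire], hence a rotation of the orbit
    of its root; rotating the edges only rotates the word. *)
Lemma closed_loopP c : reflect (closed_loop s c) (c \in loop_words).
Proof.
apply: (iffP mapP) => [[t]|[e [w [[]]]]].
  rewrite mem_filter => /andP[t_root _] ->.
  by exists (edges (orb (edge_src t))), (loop_word t); split=> //;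
    apply: directed_cycle_loop.
case: e => // t e _ uniq_e [x /= /andP[/eqP <- /fpath_walk cycle_e]] Ew ->.
have {}cycle_e : fcycle wire (map (@edge_src n) (t :: e)) by [].
set p := map _ _ in uniq_e cycle_e.
pose r := froot wire (edge_src t).
have t_r : fconnect wire (edge_src t) r by apply: connect_root.
have r_p : r \in p.
  by rewrite -(fconnect_cycle cycle_e (x := edge_src t)) ?mem_head.
have /mapP[u u_e Er] := r_p.
(* If the root were connected to A_0, then A_n would lie on the cycle, but no edge has source
   A_n. *)
have u_root : is_loop_root u.
  rewrite /is_loop_root -Er roots_root //=; apply/negP; rewrite symf => r_0.
  have := connect_trans r_0 fconnect_spine.
  rewrite (fconnect_cycle cycle_e) // => /mapP[v _ /esym /eqP].
  by rewrite (negPf (edge_src_neq_max v)).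
exists u; first by rewrite mem_filter u_root mem_enum.
apply/eqmodP/rotationP; rewrite /= Ew -Er.
have [i ->] := orbit_rot_cycle cycle_e uniq_e r_p.
by rewrite -map_rot edges_map; apply: walk_word_rot.
Qed.

Definition wiring_mono : trace_monomial n :=
  (FMonom spine_word, [cmonom 1 | c in [fset c in loop_words]]%M%fset).

Lemma wiring_monoE c : wiring_mono.2 c = (c \in loop_words) :> nat.
Proof. by rewrite cmE /= fsfunE !inE; case: (c \in _). Qed.

Lemma wiring_monoP : wiring_monomial s wiring_mono.
Proof.
split; first by have [q [_ _ w]] := orbit_spine; eexists; split; first exact: w.
move=> c; rewrite wiring_monoE; congr nat_of_bool.
exact/closed_loopP/asboolP.
Qed.

End WiringLoops.


(** * The labelling sum of one permutation as a monomial evaluation *)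

Section WiringSum.
Variables (n : nat) (s : 'S_n).
Notation orb x := (fingraph.orbit (wire s) x).

Definition wire_cycles : seq (seq 'I_n.+1) :=
  orb ord0 :: [seq orb (edge_src t) | t <- loop_roots s].

Lemma wire_cycles_neq0 : [::] \notin wire_cycles.
Proof.
by apply/negP; rewrite inE => /orP[/eqP|/mapP[t _]];
  rewrite /fingraph.orbit -orderSpred.
Qed.

Lemma fcycle_wire_cycles : all (fcycle (wire s)) wire_cycles.
Proof.
apply/allP=> c; rewrite inE => /orP[/eqP ->|/mapP[t _ ->]];
  exact: cycle_orbit (@wire_inj n s) _.
Qed.

(** The root of a vertex off the spine is off the spine too, so it differs from A_n and is the
    source of an edge. *)
Lemma mem_wire_cycles x : x \in flatten wire_cycles.
Proof.
have symf := fconnect_sym (@wire_inj n s).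
rewrite /= mem_cat -fconnect_orbit; case: (boolP (fconnect _ _ _)) => //= x_0.
have x_r := connect_root (frel (wire s)) x.
have r_0 : ~~ fconnect (wire s) ord0 (froot (wire s) x).
  by apply: contraNN x_0 => /connect_trans; apply; rewrite symf.
have [|t Er] := @edge_of_eqP n (froot (wire s) x).
  by apply: contraNneq r_0 => ->; apply: fconnect_spine.
apply/flatten_mapP; exists t; last by rewrite -fconnect_orbit -Er symf.
by rewrite mem_filter mem_enum /is_loop_root -Er (roots_root symf) /= r_0.
Qed.

Lemma uniq_flatten_map (S T : eqType) (F : S -> seq T) (r : seq S) :
    uniq r -> (forall x, uniq (F x)) ->
    {in r &, forall x y z, z \in F x -> z \in F y -> x = y} ->
  uniq (flatten (map F r)).
Proof.
move=> uniq_r uniq_F; elim: r uniq_r => //= x r IH /andP[xr uniq_r] inj_F.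
rewrite cat_uniq uniq_F IH // ?andbT /= => [|y z y_r z_r]; last first.
  by apply: inj_F; rewrite inE ?y_r ?z_r orbT.
apply/hasPn=> z /flatten_mapP[y yr zy]; apply: contraNN xr => zx.
by rewrite (inj_F x y _ _ z) ?mem_head // inE yr orbT.
Qed.

Lemma uniq_wire_cycles : uniq (flatten wire_cycles).
Proof.
have symf := fconnect_sym (@wire_inj n s).
rewrite /= cat_uniq orbit_uniq /=; apply/andP; split.
  apply/hasPn=> x /flatten_mapP[t]; rewrite mem_filter => /andP[/andP[_ t_0] _].
  rewrite -!fconnect_orbit symf => x_t; apply: contraNN t_0 => x_0.
  exact: connect_trans x_0 x_t.
apply: uniq_flatten_map => [||t u]; first exact/filter_uniq/enum_uniq.
  by move=> t; apply: orbit_uniq.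
rewrite !mem_filter => /andP[/andP[/eqP rt _] _] /andP[/andP[/eqP ru _] _] x.
rewrite -!fconnect_orbit => tx; rewrite symf => /(connect_trans tx).
by rewrite -root_connect // rt ru => /eqP/edge_src_inj.
Qed.

Variables (C : numClosedFieldType) (d : nat) (A : gen n -> 'M[C]_d).

Section EdgeMatrix.
Variable D : 'M[C]_d.

Definition edge_mx (x : 'I_n.+1) : 'M[C]_d :=
  if edge_of x is Some t then A (t, s t) else D.

Lemma edge_mx_word p : @ord_max n \notin p ->
  \prod_(x <- rev p) edge_mx x = word_eval A (walk_word s (edges p)).
Proof.
move=> p_max; rewrite -[in LHS](map_edges p_max) -map_rev big_map.
rewrite /word_eval /walk_word -map_rev big_map; apply: eq_bigr => t _.
by rewrite /edge_mx edge_srcK.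
Qed.

End EdgeMatrix.

(** The support of the commutative part is the set of loop words, each with exponent 1, and a trace
    does not depend on the word chosen in its cyclic class. *)
Lemma trace_monomial_eval_wiring :
  trace_monomial_eval A (wiring_mono s) =
  (\prod_(t <- loop_roots s)
     \tr (word_eval A (walk_word s (edges (orb (edge_src t))))))
  *: word_eval A (spine_word s).
Proof.
rewrite /trace_monomial_eval; congr (_ *: _).
transitivity (\prod_(c <- loop_words s) trace_eval A c); last first.
  by rewrite big_map; apply: eq_bigr => t _; rewrite trace_eval_pi.
have supp : perm_eq (finsupp (cmonom_val (wiring_mono s).2)) (loop_words s).
  apply: uniq_perm; rewrite ?fset_uniq ?uniq_loop_words // => c.
  by rewrite -cmE_neq0 wiring_monoE; case: (c \in _).
rewrite (perm_big _ supp) /= big_seq [RHS]big_seq; apply: eq_bigr => c c_in.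
by rewrite wiring_monoE c_in expr1.
Qed.

Lemma sum_wiring (i j : 'I_d) :
  \sum_(a : {ffun 'I_n.+1 -> 'I_d} | (a ord_max == i) && (a ord0 == j))
    \prod_(t < n) A (t, s t) (a (edge_tgt s t)) (a (edge_src t))
  = trace_monomial_eval A (wiring_mono s) i j.
Proof.
(* On the added edge, the entry at row [a ord0] and column [a ord_max] is the indicator of both
   boundary conditions. *)
pose B := edge_mx (delta_mx j i).
transitivity (\sum_(a : {ffun 'I_n.+1 -> 'I_d})
    \prod_x B x (a (wire s x)) (a x)).
  rewrite big_mkcond; apply: eq_bigr => a _; rewrite big_ord_recr /=.
  rewrite /B /edge_mx edge_of_max wire_max mxE.
  under [in RHS]eq_bigr => t _ do rewrite edge_srcK wire_src.
  rewrite andbC [_ == j]eq_sym [_ == i]eq_sym.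
  by case: ifP => _; rewrite ?mulr1 ?mulr0.
rewrite (sum_cycle_weight B i wire_cycles_neq0 fcycle_wire_cycles
  uniq_wire_cycles mem_wire_cycles).
rewrite big_cons trace_monomial_eval_wiring [RHS]mxE mulrC; congr (_ * _).
  rewrite big_map big_seq [RHS]big_seq; apply: eq_bigr => t.
  rewrite mem_filter => /andP[t_root _].
  by rewrite edge_mx_word ?orbit_max.
have [q [orb_q q_max _]] := orbit_spine s.
(* A_n comes last in the orbit of A_0, so after reversal the elementary matrix is the leftmost
   factor. *)
rewrite /spine_word orb_q rev_rcons big_cons edge_mx_word //.
rewrite /B /edge_mx edge_of_max -cats1 /edges pmap_cat /= edge_of_max cats0.
set W := word_eval _ _; rewrite -[_ * W]/(delta_mx j i *m W) mxtrace_mulC.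
rewrite /mxtrace (bigD1 i) //= big1 ?addr0 => [|k k_i].
  rewrite mxE (bigD1 j) //= big1 ?addr0 => [|l l_j].
    by rewrite mxE !eqxx mulr1.
  by rewrite mxE (negPf l_j) mulr0.
by rewrite mxE big1 // => l _; rewrite mxE (negPf k_i) andbF mulr0.
Qed.

End WiringSum.


(** * Evaluation of a trace polynomial given as a sum of monomials *)

Section TracePolySum.
Variables (C : numClosedFieldType) (n : nat) (I : finType).
Variables (F : I -> trace_monomial n) (c : I -> C).

Definition trace_poly_sum : trace_poly C n := \sum_i << c i *g F i >>.

Lemma mcoeff_trace_poly_sum mu :
  trace_poly_sum@_mu = \sum_i c i *+ (F i == mu).
Proof. by rewrite raddf_sum; apply: eq_bigr => i _; rewrite /= mcoeffU. Qed.

Lemma msupp_trace_poly_sum mu :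
  mu \in msupp trace_poly_sum -> exists i, mu = F i.
Proof.
rewrite -mcoeff_neq0 mcoeff_trace_poly_sum.
case: (pickP (fun i => F i == mu)) => [i /eqP <- _|F_mu]; first by exists i.
by rewrite big1 ?eqxx // => i _; rewrite F_mu.
Qed.

(** Terms with equal monomials may merge or cancel, so the sum over the support is first enlarged to
    the image of [F], where the extra coefficients are zero, and then exchanged with the sum over
    [i]. *)
Lemma trace_poly_eval_sum d (A : gen n -> 'M[C]_d) :
  trace_poly_eval A trace_poly_sum = \sum_i c i *: trace_monomial_eval A (F i).
Proof.
pose D := [fset F i | i : I]%fset.
have subD : (msupp trace_poly_sum `<=` D)%fset.
  apply/fsubsetP=> mu /msupp_trace_poly_sum[i ->]; exact: in_imfset.
rewrite /trace_poly_eval (big_fset_incl _ subD) => [|mu _]; last first.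
  by rewrite -mcoeff_eq0 => /eqP ->; rewrite scale0r.
under eq_bigr do rewrite mcoeff_trace_poly_sum scaler_suml.
rewrite exchange_big; apply: eq_bigr => i _.
rewrite (big_fsetD1 (F i)) ?in_imfset //= eqxx big1_fset ?addr0 // => mu.
by rewrite !inE eq_sym => /andP[/negPf-> _] _; rewrite scale0r.
Qed.

End TracePolySum.

(** * The branch operator in the computational basis *)

Lemma prodr_eq_ffun (C : comNzRingType) (n : nat) (T : eqType)
    (f g : {ffun 'I_n -> T}) :
  \prod_(t < n) (f t == g t)%:R = (f == g)%:R :> C.
Proof.
case: eqVneq => [->|fg]; first by rewrite big1 // => t _; rewrite eqxx.
have [t ft] : exists t, f t != g t.
  apply/existsP; apply: contraR fg; rewrite negb_exists => /forallP fg.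
  by apply/eqP/ffunP=> t; apply/eqP; have := fg t; rewrite negbK.
by rewrite (bigD1 t) //= (negPf ft) mul0r.
Qed.

(** The permutation operator of [s^-1] sends the basis vector of [y] to that of [y o s], so a single
    intermediate index survives. *)
Lemma det_tensorE (C : numClosedFieldType) (d n : nat)
    (S : 'I_n -> 'I_n -> 'M[C]_d) (x y : multi_index d n) :
  det_tensor S x y =
  \sum_(s : 'S_n) (-1) ^+ s * \prod_(t < n) S t (s t) (x t) (y (s t)).
Proof.
apply: eq_bigr => s _; congr (_ * _); rewrite /op_mul /op_perm invgK.
rewrite (bigD1 [ffun t => y (s t)]) //= eqxx mulr1 big1 ?addr0 => [|z /negPf->].
  by apply: eq_bigr => t _; rewrite ffunE.
by rewrite mulr0.
Qed.

(** Only [u = v = y] contributes, and the normalisation is real, hence fixed by conjugation. *)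
Lemma bell_braE (R : realType) (d : nat) (b : 'I_d * 'I_d) (x y : 'I_d) :
  bell_bra R b x y = (sqrtC d%:R)^-1 * weyl R b y x.
Proof.
rewrite /bell_bra (bigD1 y) //= [X in _ + X]big1 ?addr0 => [|u u_y].
  rewrite (bigD1 y) //= big1 ?addr0 => [|v v_y].
    rewrite /max_ent eqxx [1%:M _ _]mxE eqxx !mulr1; congr (_ * _).
    by apply/conj_Creal/ger0_real; rewrite invr_ge0 sqrtC_ge0 ler0n.
  by rewrite [1%:M _ _]mxE (negPf v_y) !mulr0.
apply: big1 => v _; rewrite /max_ent [1%:M _ _]mxE.
case: (eqVneq u v) => [<-|_]; first by rewrite (negPf u_y) !mulr0.
by rewrite mulr0 rmorph0 mul0r.
Qed.

(** Summing over the states of Q_1, ..., Q_n joins each transposed block to its Weyl operator, which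
    yields the dressed blocks. *)
Lemma sum_prod_mulmx_tr (C : comNzRingType) (d n : nat) (D E : 'I_n -> 'M[C]_d)
    (x y : 'I_n -> 'I_d) :
  \sum_(q : {ffun 'I_n -> 'I_d})
    (\prod_(t < n) D t (q t) (x t)) * \prod_(t < n) E t (q t) (y t)
  = \prod_(t < n) ((E t)^T *m D t) (y t) (x t).
Proof.
under [RHS]eq_bigr do rewrite mxE.
rewrite bigA_distr_bigA; apply: eq_bigr => q _; rewrite -big_split.
by apply: eq_bigr => t _; rewrite mxE mulrC.
Qed.

Lemma distr_sum_sum (C : comNzRingType) (Q S : finType) (u e : C) (g : S -> C)
    (F : Q -> C) (G : S -> Q -> C) :
  \sum_q (u * F q) * (e * (u * \sum_s g s * G s q))
  = e * \sum_s (u * u * g s) * \sum_q F q * G s q.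
Proof.
under [in RHS]eq_bigr do rewrite big_distrr.
rewrite exchange_big big_distrr; apply: eq_bigr => q _ /=.
rewrite !big_distrr /=; apply: eq_bigr => s _; ring.
Qed.

Lemma branch_opE (R : realType) (d n : nat) (b : 'I_n -> 'I_d * 'I_d)
    (S : 'I_n -> 'I_n -> 'M[R[i]]_d) (i j : 'I_d) :
  branch_op b S i j =
  \sum_(s : 'S_n) (d%:R ^- n * (-1) ^+ s) *
    \sum_(a : {ffun 'I_n.+1 -> 'I_d} | (a ord_max == i) && (a ord0 == j))
      \prod_(t < n)
        dressed b S (t, s t) (a (edge_tgt s t)) (a (edge_src t)).
Proof.
pose r : R[i] := (sqrtC d%:R)^-1.
(* The [n] Bell projections and the [n] entangled pairs each contribute a factor [r]. *)
have r2 : r ^+ n * r ^+ n = d%:R ^- n.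
  by rewrite -exprMn -expr2 exprVn sqrtCK exprVn.
have r_n : r ^+ n = \prod_(k < n) r by rewrite prodr_const card_ord.
have bell_prod (a : {ffun 'I_n.+1 -> 'I_d}) (q : multi_index d n) :
    \prod_(t < n) bell_bra R (b t) (a (widen_ord (leqnSn n) t)) (q t)
    = r ^+ n * \prod_(t < n) weyl R (b t) (q t) (a (edge_src t)).
  by rewrite r_n -big_split; apply: eq_bigr => t _; apply: bell_braE.
(* The entangled pairs force [q' k = a (lift ord0 k)], and the input basis vector forces
   [a ord0 = j]. *)
have inner (a : {ffun 'I_n.+1 -> 'I_d}) (q : multi_index d n) :
    \sum_(q' : multi_index d n) det_tensor S q q' *
      ((delta_mx j 0 : 'cV_d) (a ord0) 0 *
       \prod_(k < n) max_ent R (q' k) (a (lift ord0 k)))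
    = (a ord0 == j)%:R * (r ^+ n *
        \sum_(s : 'S_n) (-1) ^+ s *
          \prod_(t < n) S t (s t) (q t) (a (edge_tgt s t))).
  have -> : \sum_(s : 'S_n) (-1) ^+ s *
      \prod_(t < n) S t (s t) (q t) (a (edge_tgt s t)) =
      det_tensor S q [ffun k => a (lift ord0 k)].
    rewrite det_tensorE; apply: eq_bigr => s _; congr (_ * _).
    by apply: eq_bigr => t _; rewrite ffunE.
  rewrite (bigD1 [ffun k => a (lift ord0 k)]) //= [X in _ + X]big1 ?addr0.
    rewrite mxE eqxx andbT mulrC -mulrA; congr (_ * (_ * _)).
    by rewrite r_n; apply: eq_bigr => k _; rewrite /max_ent ffunE eqxx mulr1.
  move=> q' q'_a.
  have -> : \prod_(k < n) max_ent R (q' k) (a (lift ord0 k)) = 0.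
    transitivity (\prod_(k < n) r *
      \prod_(k < n) (q' k == [ffun k => a (lift ord0 k)] k)%:R).
      by rewrite -big_split; apply: eq_bigr => k _; rewrite ffunE.
    by rewrite prodr_eq_ffun (negPf q'_a) mulr0.
  by rewrite !mulr0.
rewrite !mxE.
under [RHS]eq_bigr do rewrite big_distrr.
rewrite [RHS]exchange_big [RHS]big_mkcondr; apply: eq_bigr => a _.
transitivity ((a ord0 == j)%:R * \sum_(s : 'S_n) d%:R ^- n * (-1) ^+ s *
    \sum_(q : {ffun 'I_n -> 'I_d})
      (\prod_(t < n) weyl R (b t) (q t) (a (edge_src t))) *
      \prod_(t < n) S t (s t) (q t) (a (edge_tgt s t))).
  rewrite -r2 -distr_sum_sum; apply: eq_bigr => q _; rewrite bell_prod.
  by congr (_ * _); apply: inner.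
case: (_ == j); rewrite (mul1r, mul0r) //.
by apply: eq_bigr => s _; rewrite sum_prod_mulmx_tr.
Qed.

Theorem proposition1 (R : realType) (d n : nat) (d_ge2 : (2 <= d)%N) :
  exists p : trace_poly R[i] n,
    ordered_wiring_poly p /\
    forall (m : nat) (le_nm : (n <= m)%N) (V : 'I_m -> 'I_m -> 'M[R[i]]_d)
           (l : 'I_n -> 'I_m) (b : 'I_n -> 'I_d * 'I_d),
      (\mxblock_(j < m, k < m) V j k) \is unitarymx ->
      (forall t u : 'I_n, (t < u)%N -> (l t < l u)%N) ->
      let S := post_selected le_nm V l in
      branch_op b S = trace_poly_eval (dressed b S) p.
Proof.
(* One monomial per permutation, with its sign and the normalisation as coefficient; the polynomial
   depends on [n] and [d] only, so it can be fixed before the circuit, the record and the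
   outcomes. *)
exists (trace_poly_sum (@wiring_mono n) (fun s => d%:R ^- n * (-1) ^+ s)).
split=> [mu /msupp_trace_poly_sum[s ->]|m le_nm V l b _ _ S].
  by exists s; apply: wiring_monoP.
rewrite trace_poly_eval_sum; apply/matrixP=> i j.
rewrite branch_opE summxE; apply: eq_bigr => s _.
by rewrite [RHS]mxE; congr (_ * _); apply: sum_wiring.
Qed.
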